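(* Let $M$ be a smooth manifold endowed with a tensor field $J$ of type $(1,1)$ such that $J^{2}=\alpha\, Id$, where $\alpha\in\{-1,1\}$. Let $J_{*}$ be the canonical involution induced by $J$ in the space $\mathcal{C}(M)$ of linear connections on $M$, i.e. the map that assigns to $\nabla\in\mathcal{C}(M)$ the operator $$(J_{*}(\nabla))_{X}(Y)=\alpha J(\nabla_{X}(JY)),\quad \forall X,Y\in\mathfrak{X}(M).$$ Then: 1. The map $J_{*}:\mathcal{C}(M)\to\mathcal{C}(M)$ is an involutive affine isomorphism. 2. $\mathcal{C}(M,J)=\{\nabla\in\mathcal{C}(M): J_{*}(\nabla)=\nabla\}$. 3. For each $\nabla\in\mathcal{C}(M)$, the connection $$\pi(\nabla)=\frac{1}{2}\nabla+\frac{1}{2}J_{*}(\nabla)$$ is $J$-invariant, i.e. $J_{*}(\pi(\nabla))=\pi(\nabla)$, so defining a projection $\pi:\mathcal{C}(M)\to\mathcal{C}(M,J)$. 4. In addition, if $(M,J,g)$ is a $(J^{2}=\pm1)$-metric manifold, then $\pi(\nabla^{\mathrm{g}})=\nabla^{0}$, where $\nabla^{\mathrm{g}}$ is the Levi Civita connection of $g$ and $\nabla^{0}$ is the first canonical connection of $(M,J,g)$.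
   Context: All manifolds and operators are of class $C^{\infty}$; $\mathfrak{X}(M)$ is the module of vector fields on $M$, and $Id$ is the identity. $\mathcal{C}(M)$ denotes the affine space of linear connections on $M$ (modelled on the real vector space of $(1,2)$ tensor fields). $\mathcal{C}(M,J)$ denotes the subset of connections adapted to $J$, i.e. those with $\nabla J=0$, where $(\nabla_X J)Y=\nabla_X(JY)-J(\nabla_X Y)$. A map between affine spaces is affine if and only if it preserves barycentric combinations. A projection onto an affine subspace is an affine map with values in that subspace that fixes each of its points. $(J^{2}=\pm1)$-metric manifold: a triple $(M,J,g)$ where $M$ is a manifold, $g$ is a semi-Riemannian metric on $M$, $J$ is a tensor field of type $(1,1)$, and for some $\alpha,\varepsilon\in\{-1,1\}$ one has $$J^{2}=\alpha\,Id,\quad \mathrm{trace}\,J=0,\quad g(JX,JY)=\varepsilon g(X,Y),\quad\forall X,Y\in\mathfrak{X}(M),$$ $g$ being a Riemannian metric if $\varepsilon=1$. The first canonical connection $\nabla^{0}$ of a $(J^{2}=\pm1)$-metric manifold is the linear connection $$\nabla^{0}_X Y=\nabla^{\mathrm{g}}_X Y+\frac{(-\alpha)}{2}(\nabla^{\mathrm{g}}_X J)JY,\quad\forall X,Y\in\mathfrak{X}(M).$$ *)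

(* Defs.v *)
From HB Require Import structures.
From mathcomp Require Import all_boot all_order all_algebra.
From mathcomp Require Import all_classical all_reals all_analysis.
From mathcomp Require Import ring.

Set Implicit Arguments.
Unset Strict Implicit.
Unset Printing Implicit Defensive.

Import Order.TTheory GRing.Theory Num.Theory.
Import numFieldNormedType.Exports.

Local Open Scope classical_set_scope.
Local Open Scope ring_scope.

Section Euclidean.
Variables (R : realType) (n : nat).
Implicit Types (U : set 'rV[R]_n) (f g : 'rV[R]_n -> R).

(* Meaningful for open [U]: all iterated partial derivatives up to order [k]
   exist and are continuous at every point of [U]. *)
Fixpoint class_C (k : nat) U f : Prop :=
  {in U, continuous f} /\
  if k is k'.+1 then
    forall i : 'I_n, {in U, forall x, derivable f x 'e_i} /\
                     class_C k' U ('D_('e_i) f)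
  else True.

Definition smooth_on U f : Prop := forall k, class_C k U f.

Lemma class_CS k U f : class_C k.+1 U f -> class_C k U f.
Proof.
elim: k f => [|k IH] f [cf df]; first by [].
by split=> // i; have [dfi /IH] := df i.
Qed.

Lemma class_C_near k U f g : open U -> {in U, f =1 g} ->
  class_C k U f -> class_C k U g.
Proof.
move=> oU.
have near_eq f' g' x : {in U, f' =1 g'} -> x \in U -> \near x, f' x = g' x.
  move=> fg xU; have := open_nbhs_nbhs (conj oU (set_mem xU)).
  by apply: filterS => y /mem_set/fg.
elim: k f g => [|k IH] f g fg [cf df]; split=> //.
- move=> x xU; rewrite /continuous_at -(fg _ xU).
  exact: (cvg_trans (near_eq_cvg (near_eq f g x fg xU)) (cf x xU)).
- move=> x xU; rewrite /continuous_at -(fg _ xU).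
  exact: (cvg_trans (near_eq_cvg (near_eq f g x fg xU)) (cf x xU)).
move=> i; have [dfi Dfi] := df i; split.
  move=> x xU; apply: near_eq_derivable (dfi x xU); exact: (near_eq f g).
apply: IH Dfi => x xU; apply: near_eq_derive; exact: (near_eq f g).
Qed.

Lemma class_C_cst k U (a : R) : open U -> class_C k U (fun=> a).
Proof.
move=> oU; elim: k a => [|k IH] a; split=> //;
  try by move=> x _; exact: cst_continuous.
move=> i; split; first by move=> x _; exact: derivable_cst.
apply: (class_C_near oU _ (IH 0)) => x _; apply/esym; exact: derive_cst.
Qed.

Lemma class_CD k U f g : open U ->
  class_C k U f -> class_C k U g -> class_C k U (f + g).
Proof.
move=> oU; elim: k f g => [|k IH] f g [cf df] [cg dg];
  split=> //; try by move=> x xU; exact: (continuousD (cf x xU) (cg x xU)).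
move=> i; have [dfi Dfi] := df i; have [dgi Dgi] := dg i; split.
  by move=> x xU; apply: derivableD; [exact: dfi|exact: dgi].
apply: (class_C_near oU _ (IH _ _ Dfi Dgi)) => x xU.
by rewrite deriveD; [|exact: dfi|exact: dgi].
Qed.

Lemma class_CM k U f g : open U ->
  class_C k U f -> class_C k U g -> class_C k U (f * g).
Proof.
move=> oU; elim: k f g => [|k IH] f g Cf Cg;
  have [cf df] := Cf; have [cg dg] := Cg;
  split=> //; try by move=> x xU; exact: (continuousM (cf x xU) (cg x xU)).
move=> i; have [dfi Dfi] := df i; have [dgi Dgi] := dg i; split.
  by move=> x xU; apply: derivableM; [exact: dfi|exact: dgi].
apply: (class_C_near oU _ (class_CD oU (IH _ _ (class_CS Cf) Dgi)
                                       (IH _ _ (class_CS Cg) Dfi))) => x xU.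
by rewrite deriveM; [|exact: dfi|exact: dgi].
Qed.

End Euclidean.

(* The maps are total functions; only their values on [chart_dom], resp.
   [chart_cod], matter. *)
Record chart (R : realType) (n : nat) (T : topologicalType) := Chart {
  chart_dom : set T;
  chart_cod : set 'rV[R]_n;
  chart_map : T -> 'rV[R]_n;
  chart_inv : 'rV[R]_n -> T;
  chart_dom_open : open chart_dom;
  chart_cod_open : open chart_cod;
  chart_map_fun : set_fun chart_dom chart_cod chart_map;
  chart_inv_fun : set_fun chart_cod chart_dom chart_inv;
  chart_mapK : {in chart_dom, cancel chart_map chart_inv};
  chart_invK : {in chart_cod, cancel chart_inv chart_map};
  chart_map_continuous : {in chart_dom, continuous chart_map};
  chart_inv_continuous : {in chart_cod, continuous chart_inv} }.

Definition smooth_transition (R : realType) (n : nat) (T : topologicalType)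
    (c d : chart R n T) : Prop :=
  forall j : 'I_n,
    smooth_on (chart_cod c `&` chart_inv c @^-1` chart_dom d)
              (fun x => chart_map d (chart_inv c x) ord0 j).

(* The atlas need not be maximal. *)
Record manifold (R : realType) (n : nat) := Manifold {
  mfd_space :> topologicalType;
  atlas : set (chart R n mfd_space);
  manifold_hausdorff : hausdorff_space mfd_space;
  manifold_second_countable : @second_countable mfd_space;
  atlas_cover : forall p : mfd_space, exists2 c, atlas c & chart_dom c p;
  atlas_compatible : forall c d, atlas c -> atlas d -> smooth_transition c d }.

Section SmoothFunctions.
Variables (R : realType) (n : nat) (M : manifold R n).

Definition smooth (f : M -> R) : Prop :=
  forall c, atlas c -> smooth_on (chart_cod c) (f \o chart_inv c).

Definition smooth_pred : {pred M -> R} := fun f => `[< smooth f >].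

Lemma smooth_cst a : smooth (fun=> a).
Proof. move=> c _ k; apply: class_C_cst; exact: chart_cod_open. Qed.

Lemma smoothD f g : smooth f -> smooth g -> smooth (f + g).
Proof.
move=> sf sg c Ac k.
exact: (class_CD (@chart_cod_open _ _ _ c) (sf c Ac k) (sg c Ac k)).
Qed.

Lemma smoothM f g : smooth f -> smooth g -> smooth (f * g).
Proof.
move=> sf sg c Ac k.
exact: (class_CM (@chart_cod_open _ _ _ c) (sf c Ac k) (sg c Ac k)).
Qed.

Lemma smoothN f : smooth f -> smooth (- f).
Proof.
move=> sf; have -> : - f = (fun=> -1) * f.
  by apply/funext => x; rewrite mulrfctE mulN1r.
apply: smoothM => //; exact: smooth_cst.
Qed.

Lemma smooth_subring : subring_closed smooth_pred.
Proof.
split.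
- by apply/asboolP; exact: smooth_cst.
- move=> f g /asboolP sf /asboolP sg; apply/asboolP.
  by apply: smoothD => //; exact: smoothN.
- by move=> f g /asboolP sf /asboolP sg; apply/asboolP; exact: smoothM.
Qed.

HB.instance Definition _ :=
  GRing.isSubringClosed.Build (M -> R) smooth_pred smooth_subring.

Record smoothfun := SmoothFun_ {
  sf_val :> M -> R;
  sf_smooth_pred : sf_val \in smooth_pred }.

HB.instance Definition _ := [isSub for sf_val].
HB.instance Definition _ := [Choice of smoothfun by <:].
HB.instance Definition _ := 
  GRing.SubChoice_isSubComPzRing.Build _ _ smoothfun (GRing.subringClosedP _).

Definition SmoothFun (f : M -> R) (sf : smooth f) : smoothfun :=
  SmoothFun_ (introT (asboolP _) sf).

Lemma sf_smooth (f : smoothfun) : smooth f.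
Proof. by case: f => f /= /asboolP. Qed.

Lemma smoothfunP (f g : smoothfun) : (forall p, f p = g p) <-> f = g.
Proof. by split=> [fg|->//]; apply/val_inj/funext. Qed.

(* [smoothfun] is the zero ring on the empty manifold, hence it cannot be
   declared an algebra over [R] and [a%:A] is not available. *)
Definition sf_cst (a : R) : smoothfun := SmoothFun (smooth_cst a).
Definition sf_scale (a : R) (f : smoothfun) : smoothfun := sf_cst a * f.

Lemma sf_scaleA a b f : sf_scale a (sf_scale b f) = sf_scale (a * b) f.
Proof. by apply/smoothfunP => p /=; exact: mulrA. Qed.
Lemma sf_scale1 : left_id 1 sf_scale.
Proof. by move=> f; apply/smoothfunP => p /=; exact: mul1r. Qed.
Lemma sf_scaleDr : right_distributive sf_scale +%R.
Proof. by move=> a f g; apply/smoothfunP => p /=; exact: mulrDr. Qed.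
Lemma sf_scaleDl f : {morph sf_scale^~ f : a b / a + b}.
Proof. by move=> a b; apply/smoothfunP => p /=; exact: mulrDl. Qed.

HB.instance Definition _ := GRing.Zmodule_isLmodule.Build R smoothfun
  sf_scaleA sf_scale1 sf_scaleDr sf_scaleDl.

Lemma sfZE a (f : smoothfun) p : (a *: f) p = a * f p. Proof. by []. Qed.

End SmoothFunctions.

Arguments SmoothFun {R n M} f sf.

Section Tangent.
Variables (R : realType) (n : nat) (M : manifold R n) (p : M).

(* Tangent vectors at [p] are the derivations at [p] of the global smooth
   functions; [M] being Hausdorff, global functions suffice. *)
Definition derivation_at (v : smoothfun M -> R) : Prop :=
  (forall a f g, v (a *: f + g) = a * v f + v g) /\
  (forall f g, v (f * g) = v f * g p + f p * v g).

Definition derivation_pred : {pred smoothfun M -> R^o} :=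
  fun v => `[< derivation_at v >].

Lemma derivation_submod : submod_closed derivation_pred.
Proof.
split.
  by apply/asboolP; split=> *; rewrite /= ?(mulr0, mul0r) addr0.
move=> a u v /asboolP[lu mu] /asboolP[lv mv]; apply/asboolP; split=> [b f g|f g];
  rewrite !(fctE, scalrfctE) /= /GRing.scale /=.
- by rewrite lu lv !mulrDr !mulrA (mulrC a b) addrACA.
- by rewrite mu mv !mulrDr !mulrDl !mulrA (mulrC a (f p)) addrACA.
Qed.

HB.instance Definition _ := GRing.isSubmodClosed.Build R (smoothfun M -> R^o)
  derivation_pred derivation_submod.

Record tangent := Tangent_ {
  tan_val :> smoothfun M -> R^o;
  tan_pred : tan_val \in derivation_pred }.

HB.instance Definition _ := [isSub for tan_val].
HB.instance Definition _ := [Choice of tangent by <:].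
HB.instance Definition _ := [SubChoice_isSubLmodule of tangent by <:].

Definition Tangent (v : smoothfun M -> R) (dv : derivation_at v) : tangent :=
  Tangent_ (introT (asboolP _) dv).

Lemma tan_derivation (v : tangent) : derivation_at v.
Proof. by case: v => v /= /asboolP. Qed.

Lemma tangentP (u v : tangent) : (forall f, u f = v f) <-> u = v.
Proof. by split=> [uv|->//]; apply/val_inj/funext. Qed.

End Tangent.

Arguments Tangent {R n M p} v dv.

Section VectorFields.
Variables (R : realType) (n : nat) (M : manifold R n).

Definition smooth_field (X : forall p : M, tangent p) : Prop :=
  forall f : smoothfun M, smooth (fun p => X p f).

Record vfield := VField {
  vf_val :> forall p : M, tangent p;
  vf_smooth : smooth_field vf_val }.

HB.instance Definition _ := gen_eqMixin vfield.
HB.instance Definition _ := gen_choiceMixin vfield.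

Lemma vfieldP (X Y : vfield) : (forall p, X p = Y p) <-> X = Y.
Proof.
split=> [XY|->//]; case: X Y XY => [X sX] [Y sY] /= XY.
have e : X = Y by apply: functional_extensionality_dep.
by case: _ / e sY => sY; congr VField; exact: Prop_irrelevance.
Qed.

(* the function $Xf$ *)
Definition vf_app (X : vfield) (f : smoothfun M) : smoothfun M :=
  SmoothFun (fun p => X p f) (vf_smooth X f).

Lemma vf_zero_smooth : smooth_field (fun p => 0).
Proof. by move=> f; exact: smooth_cst. Qed.
Lemma vf_opp_smooth (X : vfield) : smooth_field (fun p => - X p).
Proof. by move=> f; exact: smoothN (vf_smooth X f). Qed.
Lemma vf_add_smooth (X Y : vfield) : smooth_field (fun p => X p + Y p).
Proof. by move=> f; exact: smoothD (vf_smooth X f) (vf_smooth Y f). Qed.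
Lemma vf_scale_smooth (h : smoothfun M) (X : vfield) :
  smooth_field (fun p => h p *: X p).
Proof. by move=> f; exact: smoothM (sf_smooth h) (vf_smooth X f). Qed.

Definition vf_zero := VField vf_zero_smooth.
Definition vf_opp X := VField (@vf_opp_smooth X).
Definition vf_add X Y := VField (@vf_add_smooth X Y).
Definition vf_scale h X := VField (@vf_scale_smooth h X).

Lemma vf_addA : associative vf_add.
Proof. by move=> X Y Z; apply/vfieldP => p /=; exact: addrA. Qed.
Lemma vf_addC : commutative vf_add.
Proof. by move=> X Y; apply/vfieldP => p /=; exact: addrC. Qed.
Lemma vf_add0 : left_id vf_zero vf_add.
Proof. by move=> X; apply/vfieldP => p /=; exact: add0r. Qed.
Lemma vf_addN : left_inverse vf_zero vf_opp vf_add.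
Proof. by move=> X; apply/vfieldP => p /=; exact: addNr. Qed.

HB.instance Definition _ :=
  GRing.isZmodule.Build vfield vf_addA vf_addC vf_add0 vf_addN.

Lemma vf_scaleA g h X : vf_scale g (vf_scale h X) = vf_scale (g * h) X.
Proof. by apply/vfieldP => p /=; exact: scalerA. Qed.
Lemma vf_scale1 : left_id 1 vf_scale.
Proof. by move=> X; apply/vfieldP => p /=; exact: scale1r. Qed.
Lemma vf_scaleDr : right_distributive vf_scale +%R.
Proof. by move=> h X Y; apply/vfieldP => p /=; exact: scalerDr. Qed.
Lemma vf_scaleDl X : {morph vf_scale^~ X : g h / g + h}.
Proof. by move=> g h; apply/vfieldP => p /=; exact: scalerDl. Qed.

HB.instance Definition _ := GRing.Zmodule_isLmodule.Build (smoothfun M) vfield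
  vf_scaleA vf_scale1 vf_scaleDr vf_scaleDl.

Lemma vf_appD X (f g : smoothfun M) : vf_app X (f + g) = vf_app X f + vf_app X g.
Proof.
apply/smoothfunP => p /=; have [lX _] := tan_derivation (X p).
by have := lX 1 f g; rewrite scale1r mul1r.
Qed.

Lemma vf_appZ X a (f : smoothfun M) : vf_app X (a *: f) = a *: vf_app X f.
Proof.
apply/smoothfunP => p; rewrite sfZE /=; have [lX _] := tan_derivation (X p).
have X0 : X p 0 = 0.
  by have := lX 1 0 0; rewrite scale1r mul1r addr0 => /eqP;
     rewrite -subr_eq0 opprD addNKr oppr_eq0 => /eqP.
by have := lX a f 0; rewrite !addr0 X0 addr0.
Qed.

Lemma vf_appM X (f g : smoothfun M) :
  vf_app X (f * g) = vf_app X f * g + f * vf_app X g.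
Proof. by apply/smoothfunP => p /=; have [_ ->] := tan_derivation (X p). Qed.

Lemma lie_bracket_derivation (X Y : vfield) (p : M) :
  derivation_at p (fun f => X p (vf_app Y f) - Y p (vf_app X f)).
Proof.
have [lX mX] := tan_derivation (X p); have [lY mY] := tan_derivation (Y p).
split=> [a f g|f g].
  rewrite !vf_appD !vf_appZ lX lY mulrBr opprD.
  by rewrite addrACA.
rewrite !vf_appM.
have aX u v : X p (u + v) = X p u + X p v.
  by have := lX 1 u v; rewrite scale1r mul1r.
have aY u v : Y p (u + v) = Y p u + Y p v.
  by have := lY 1 u v; rewrite scale1r mul1r.
rewrite aX aY !mX !mY /=.
by rewrite mulrBl mulrBr; ring.
Qed.

Definition lie_bracket_at (X Y : vfield) (p : M) : tangent p :=
  Tangent _ (lie_bracket_derivation X Y p).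

Lemma lie_bracket_smooth X Y : smooth_field (lie_bracket_at X Y).
Proof.
by move=> f; exact: sf_smooth (vf_app X (vf_app Y f) - vf_app Y (vf_app X f)).
Qed.

Definition lie_bracket X Y : vfield := VField (@lie_bracket_smooth X Y).

End VectorFields.

Section LinearAlgebra.
Variables (R : realType) (V : lmodType R).

Definition is_basis (m : nat) (e : 'I_m -> V) : Prop :=
  forall v : V, exists! c : 'rV[R]_m, v = \sum_i c ord0 i *: e i.

(* [t] is the trace of the endomorphism [phi] of the finite-dimensional
   space [V]. *)
Definition is_trace (phi : V -> V) (t : R) : Prop :=
  exists (m : nat) (e : 'I_m -> V) (A : 'M[R]_m),
    [/\ is_basis e, forall j, phi (e j) = \sum_i A i j *: e i & t = \tr A].

(* [e] is then automatically linearly independent. *)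
Definition negative_definite_on (b : V -> V -> R) (m : nat) (e : 'I_m -> V) :=
  forall c : 'rV[R]_m, c != 0 ->
    b (\sum_i c ord0 i *: e i) (\sum_i c ord0 i *: e i) < 0.

(* maximal dimension of a subspace on which [b] is negative definite *)
Definition is_index (b : V -> V -> R) (nu : nat) : Prop :=
  (exists e : 'I_nu -> V, negative_definite_on b e) /\
  (forall m (e : 'I_m -> V), negative_definite_on b e -> (m <= nu)%N).

End LinearAlgebra.

Section Tensors.
Variables (R : realType) (n : nat) (M : manifold R n).

Record tensor11 := Tensor11 {
  t11_at : forall p : M, tangent p -> tangent p;
  t11_linear : forall p, linear (@t11_at p);
  t11_smooth : forall X : vfield M, smooth_field (fun p => t11_at (X p)) }.

Definition t11_app (J : tensor11) (X : vfield M) : vfield M :=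
  VField (t11_smooth J X).

Record semi_riemannian := SemiRiemannian {
  metric_at : forall p : M, tangent p -> tangent p -> R;
  metric_linear : forall p (w : tangent p) (a : R) u v,
    metric_at (a *: u + v) w = a * metric_at u w + metric_at v w;
  metric_sym : forall p (u v : tangent p), metric_at u v = metric_at v u;
  metric_nondeg : forall p (u : tangent p),
    (forall v, metric_at u v = 0) -> u = 0;
  metric_index : exists nu : nat, forall p, is_index (@metric_at p) nu;
  metric_smooth : forall X Y : vfield M, smooth (fun p => metric_at (X p) (Y p)) }.

Definition metric_app (g : semi_riemannian) (X Y : vfield M) : smoothfun M :=
  SmoothFun (fun p => metric_at g (X p) (Y p)) (metric_smooth g X Y).

Definition riemannian (g : semi_riemannian) : Prop :=
  forall p (v : tangent p), v != 0 -> 0 < metric_at g v v.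

End Tensors.

Coercion t11_app : tensor11 >-> Funclass.
Coercion metric_app : semi_riemannian >-> Funclass.

Section Connections.
Variables (R : realType) (n : nat) (M : manifold R n).

(* As a function space this is a module over [smoothfun M]; a real scalar [a]
   acts as the constant function [sf_cst a]. *)
Definition oper := vfield M -> vfield M -> vfield M.

HB.instance Definition _ := GRing.Lmodule.on oper.

Definition is_connection (D : oper) : Prop :=
  [/\ forall f X X' Y, D (f *: X + X') Y = f *: D X Y + D X' Y,
      forall (a : R) X Y Y',
        D X (sf_cst M a *: Y + Y') = sf_cst M a *: D X Y + D X Y' &
      forall X f Y, D X (f *: Y) = vf_app X f *: Y + f *: D X Y].

Definition connections : set oper := [set D | is_connection D].

(* $(\nabla_X J)Y$ *)
Definition covJ (D : oper) (J : tensor11 M) : oper :=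
  fun X Y => D X (J Y) - J (D X Y).

Definition adapted_connections (J : tensor11 M) : set oper :=
  [set D | connections D /\ forall X Y, covJ D J X Y = 0].

Definition barycenter (m : nat) (t : 'I_m -> R) (D : 'I_m -> oper) : oper :=
  \sum_i sf_cst M (t i) *: D i.

Definition affine_subspace (A : set oper) : Prop :=
  forall (m : nat) (t : 'I_m -> R) (D : 'I_m -> oper),
    \sum_i t i = 1 -> (forall i, A (D i)) -> A (barycenter t D).

Definition affine_map (A B : set oper) (F : oper -> oper) : Prop :=
  [/\ affine_subspace A, affine_subspace B, set_fun A B F &
      forall (m : nat) (t : 'I_m -> R) (D : 'I_m -> oper),
        \sum_i t i = 1 -> (forall i, A (D i)) ->
        F (barycenter t D) = barycenter t (F \o D)].

Definition affine_isomorphism (A B : set oper) (F : oper -> oper) : Prop :=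
  affine_map A B F /\
  exists G, [/\ affine_map B A G, {in A, cancel F G} & {in B, cancel G F}].

Definition affine_projection (A B : set oper) (F : oper -> oper) : Prop :=
  [/\ B `<=` A, affine_map A B F & forall D, B D -> F D = D].

Definition Jstar (alpha : R) (J : tensor11 M) (D : oper) : oper :=
  fun X Y => sf_cst M alpha *: J (D X (J Y)).

Definition Jproj (alpha : R) (J : tensor11 M) (D : oper) : oper :=
  sf_cst M (2^-1) *: D + sf_cst M (2^-1) *: Jstar alpha J D.

Definition is_levi_civita (g : semi_riemannian M) (D : oper) : Prop :=
  [/\ is_connection D,
      forall X Y, D X Y - D Y X = lie_bracket X Y &
      forall X Y Z, vf_app X (g Y Z) = g (D X Y) Z + g Y (D X Z)].

Definition is_J2_metric (alpha epsilon : R) (J : tensor11 M)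
    (g : semi_riemannian M) : Prop :=
  [/\ (alpha = 1 \/ alpha = -1) /\ (epsilon = 1 \/ epsilon = -1),
      forall X, J (J X) = sf_cst M alpha *: X,
      forall p : M, is_trace (@t11_at _ _ _ J p) 0,
      forall X Y, g (J X) (J Y) = epsilon *: g X Y &
      epsilon = 1 -> riemannian g].

(* [Dg] is meant to be the Levi-Civita connection. *)
Definition first_canonical (alpha : R) (J : tensor11 M) (Dg : oper) : oper :=
  fun X Y => Dg X Y + sf_cst M (- alpha / 2) *: covJ Dg J X (J Y).

End Connections.

(* Main.v *)
(* J is C^oo(M)-linear on vector fields, so J_* commutes with barycentric
   combinations; the Leibniz rule survives J_* because alpha J^2 = Id, and it
   survives barycentric combinations because the weights sum to 1. Since J_* is
   an involution, pi(D) is the midpoint of D and J_*(D), which J_* fixes. *)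

Require Import Defs.
From mathcomp Require Import all_boot all_order all_algebra.
From mathcomp Require Import all_classical all_reals all_analysis.
Local Open Scope classical_set_scope.
Local Open Scope ring_scope.

Import GRing.Theory Num.Theory.

Section Constants.
Context {R : realType} {n : nat} (M : manifold R n).

Lemma sf_cst1 : sf_cst M 1 = 1.
Proof. exact/smoothfunP. Qed.

Lemma sf_cst0 : sf_cst M 0 = 0.
Proof. exact/smoothfunP. Qed.

Lemma sf_cstM a b : sf_cst M (a * b) = sf_cst M a * sf_cst M b.
Proof. exact/smoothfunP. Qed.

Lemma sf_cstD a b : sf_cst M (a + b) = sf_cst M a + sf_cst M b.
Proof. exact/smoothfunP. Qed.

Lemma sf_cst_sum m (t : 'I_m -> R) :
  sf_cst M (\sum_i t i) = \sum_i sf_cst M (t i).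
Proof. exact: (big_morph (sf_cst M) sf_cstD sf_cst0). Qed.

Lemma scaler_sf_cst_half (X : vfield M) :
  sf_cst M 2^-1 *: X + sf_cst M 2^-1 *: X = X.
Proof.
have half2 : 2^-1 + 2^-1 = 1 :> R by rewrite [RHS]splitr mul1r.
by rewrite -scalerDl -sf_cstD half2 sf_cst1 scale1r.
Qed.

Lemma barycenterE m (t : 'I_m -> R) (D : 'I_m -> oper M) X Y :
  barycenter t D X Y = \sum_i sf_cst M (t i) *: D i X Y.
Proof. by rewrite /barycenter !fct_sumE. Qed.

End Constants.

Section Tensor11Linearity.
Context {R : realType} {n : nat} {M : manifold R n} (J : tensor11 M).

(** The scalars here are smooth functions: at [p] a factor [f] is just the real number [f p], so
    fibrewise real linearity suffices. *)
Lemma t11_app_linear : linear (J : vfield M -> vfield M).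
Proof. by move=> f X Y; apply/vfieldP => p; exact: t11_linear. Qed.

Lemma t11_appD X Y : J (X + Y) = J X + J Y.
Proof. by have := t11_app_linear 1 X Y; rewrite !scale1r. Qed.

Lemma t11_app0 : J 0 = 0.
Proof. by apply: (@addrI _ (J 0)); rewrite -t11_appD !addr0. Qed.

Lemma t11_appZ f X : J (f *: X) = f *: J X.
Proof. by have := t11_app_linear f X 0; rewrite t11_app0 !addr0. Qed.

Lemma t11_app_sum m (F : 'I_m -> vfield M) :
  J (\sum_i F i) = \sum_i J (F i).
Proof. exact: (big_morph (J : vfield M -> vfield M) t11_appD t11_app0). Qed.

End Tensor11Linearity.

Section Connections.
Context {R : realType} {n : nat} {M : manifold R n}.

(** Lets the constant [alpha] pass through a connection without a derivative term. *)
Lemma connection_cst (D : oper M) a X Y : is_connection D ->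
  D X (sf_cst M a *: Y) = sf_cst M a *: D X Y.
Proof.
move=> [_ linD _].
have D0 : D X 0 = 0.
  apply: (@addrI _ (D X 0)).
  (* Additivity at zero reads $D_X 0 = D_X 0 + D_X 0$. *)
  by have := linD 1 X 0 0; rewrite sf_cst1 !scale1r !addr0.
by have := linD a X Y 0; rewrite D0 !addr0.
Qed.

Lemma connections_affine : affine_subspace (@connections R n M).
Proof.
move=> m t D t1 cD; split=> [f X X' Y|a X Y Y'|X f Y]; rewrite !barycenterE.
- rewrite scaler_sumr -big_split /=; apply: eq_bigr => i _.
  by have [-> _ _] := cD i; rewrite scalerDr !scalerA mulrC.
- rewrite scaler_sumr -big_split /=; apply: eq_bigr => i _.
  by have [_ -> _] := cD i; rewrite scalerDr !scalerA mulrC.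
(* The term $(Xf)Y$ must be shared among the summands: its coefficient 1 is rewritten as the sum of
   the weights. *)
rewrite -[in RHS](scale1r (vf_app X f *: Y)) -sf_cst1 -t1 sf_cst_sum.
rewrite scaler_suml scaler_sumr -big_split /=; apply: eq_bigr => i _.
by have [_ _ ->] := cD i; rewrite scalerDr !scalerA (mulrC f).
Qed.

End Connections.

Section Involution.
Context {R : realType} {n : nat} {M : manifold R n} {J : tensor11 M} {alpha : R}.
Hypothesis alpha1 : alpha = 1 \/ alpha = -1.
Hypothesis J2 : forall X : vfield M, J (J X) = sf_cst M alpha *: X.

Lemma sf_cst_alphaK : sf_cst M alpha * sf_cst M alpha = 1.
Proof. by rewrite -sf_cstM; case: alpha1 => ->; rewrite ?mulrNN mul1r sf_cst1. Qed.

(** Says that $\alpha J$ is inverse to $J$, the form in which the hypothesis on $J^2$ is used most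
    often. *)
Lemma scale_J2 X : sf_cst M alpha *: J (J X) = X.
Proof. by rewrite J2 scalerA sf_cst_alphaK scale1r. Qed.

Lemma Jstar_connection D : is_connection D -> is_connection (Jstar alpha J D).
Proof.
move=> [linX linY leib]; split=> [f X X' Y|a X Y Y'|X f Y]; rewrite /Jstar.
- by rewrite linX t11_appD t11_appZ scalerDr !scalerA mulrC.
- by rewrite t11_appD t11_appZ linY t11_appD t11_appZ scalerDr !scalerA mulrC.
rewrite t11_appZ leib t11_appD !t11_appZ scalerDr !scalerA.
(* The derivative term is $\alpha (Xf) J(JY)$, which [scale_J2] turns into $(Xf)Y$. *)
by rewrite (mulrC _ (vf_app X f)) -(scalerA (vf_app X f)) scale_J2 (mulrC _ f).
Qed.

(** The inner $J(JY)$ leaves $D_X$ as a constant factor $\alpha$, the two outer $J$ cancel against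
    another $\alpha$, and $\alpha^2 = 1$ removes the rest. *)
Lemma JstarK D : is_connection D -> Jstar alpha J (Jstar alpha J D) = D.
Proof.
move=> cD; apply/funext => X; apply/funext => Y.
rewrite /Jstar (J2 Y) connection_cst// !t11_appZ scale_J2.
by rewrite scalerA sf_cst_alphaK scale1r.
Qed.

Lemma Jstar_barycenter m (t : 'I_m -> R) (D : 'I_m -> oper M) :
  Jstar alpha J (barycenter t D) = barycenter t (Jstar alpha J \o D).
Proof.
apply/funext => X; apply/funext => Y.
rewrite {1}/Jstar !barycenterE t11_app_sum scaler_sumr; apply: eq_bigr => i _.
by rewrite t11_appZ !scalerA mulrC.
Qed.

Lemma Jstar_affine :
  affine_map (@connections R n M) (@connections R n M) (Jstar alpha J).
Proof.
split; try exact: connections_affine.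
- by move=> D; exact: Jstar_connection.
- by move=> m t D _ _; exact: Jstar_barycenter.
Qed.

(** Applying the invertible $\alpha J$ to $D_X(JY) = J(D_X Y)$ gives exactly $J_*(D) = D$. *)
Lemma adapted_connectionsE : adapted_connections J =
  [set D : oper M | connections D /\ Jstar alpha J D = D].
Proof.
apply/seteqP; split=> D [cD invD]; split=> //.
  apply/funext => X; apply/funext => Y; rewrite /Jstar.
  by have /eqP := invD X Y; rewrite subr_eq0 => /eqP ->; exact: scale_J2.
(* Only the $D$ inside $J(D_X Y)$ is replaced by $J_*(D)$, giving $J(\alpha J(D_X(JY))) =
   D_X(JY)$. *)
move=> X Y; apply/eqP; rewrite subr_eq0 -{2}invD /Jstar t11_appZ scale_J2.
exact/eqP.
Qed.

Lemma adapted_connections_affine : affine_subspace (adapted_connections J).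
Proof.
rewrite adapted_connectionsE => m t D t1 aD; split.
  by apply: connections_affine => // i; have [] := aD i.
rewrite Jstar_barycenter; congr barycenter.
by apply/funext => i; have [] := aD i.
Qed.

(** Presents $\pi(D)$ as a two-point barycenter, so that the results on barycenters apply to it. *)
Lemma JprojE D : Jproj alpha J D =
  barycenter (fun _ : 'I_2 => 2^-1)
             (fun i => if i == ord0 then D else Jstar alpha J D).
Proof. by rewrite /barycenter !big_ord_recl big_ord0 addr0. Qed.

Lemma Jproj_connection D : is_connection D -> is_connection (Jproj alpha J D).
Proof.
move=> cD; rewrite JprojE; apply: connections_affine => [|i].
  by rewrite !big_ord_recl big_ord0 addr0 [RHS]splitr mul1r.
by case: ifP => _ //; exact: Jstar_connection.
Qed.

Lemma Jstar_Jproj D : is_connection D ->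
  Jstar alpha J (Jproj alpha J D) = Jproj alpha J D.
Proof.
move=> cD; rewrite JprojE Jstar_barycenter /barycenter !big_ord_recl !big_ord0 /=.
(* The involution swaps the two points, which carry equal weights. *)
by rewrite JstarK// !addr0 addrC.
Qed.

Lemma Jproj_id D : Jstar alpha J D = D -> Jproj alpha J D = D.
Proof.
move=> invD; rewrite /Jproj invD.
by apply/funext => X; apply/funext => Y; exact: scaler_sf_cst_half.
Qed.

Lemma Jproj_barycenter m (t : 'I_m -> R) (D : 'I_m -> oper M) :
  Jproj alpha J (barycenter t D) = barycenter t (Jproj alpha J \o D).
Proof.
rewrite /Jproj Jstar_barycenter /barycenter !scaler_sumr -big_split /=.
apply: eq_bigr => i _.
by rewrite scalerDr !scalerA mulrC.
Qed.

Lemma Jproj_projection : affine_projection (@connections R n M)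
  (adapted_connections J) (Jproj alpha J).
Proof.
split.
- by move=> D [].
- split.
  + exact: connections_affine.
  + exact: adapted_connections_affine.
  + move=> D cD; rewrite adapted_connectionsE.
    by split; [exact: Jproj_connection|exact: Jstar_Jproj].
  + by move=> m t D _ _; exact: Jproj_barycenter.
- by rewrite adapted_connectionsE => D [_]; exact: Jproj_id.
Qed.

(** Since $J^2 = \alpha Id$, $(D_X J)JY = \alpha D_X Y - J(D_X(JY))$; the factor $-\alpha/2$ makes
    this $-\frac12 D_X Y + \frac12 (J_*(D))_X Y$. *)
Lemma Jproj_first_canonical D : is_connection D ->
  Jproj alpha J D = first_canonical alpha J D.
Proof.
move=> cD; apply/funext => X; apply/funext => Y.
rewrite /first_canonical /covJ J2 (connection_cst D)//.
have -> : sf_cst M (- alpha / 2) = - (sf_cst M 2^-1 * sf_cst M alpha).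
  by rewrite -sf_cstM mulNr mulrC; exact/smoothfunP.
rewrite scaleNr scalerBr opprB -!scalerA (scalerA _ _ (D X Y)) sf_cst_alphaK scale1r.
(* The leading $D_X Y$ is split into halves, one of which cancels. *)
by rewrite addrCA -[X in _ + (X - _)]scaler_sf_cst_half addrK addrC.
Qed.

End Involution.

Theorem proposition3p2 (R : realType) (n : nat) (M : manifold R n)
    (J : tensor11 M) (alpha : R) (halpha : alpha = 1 \/ alpha = -1)
    (hJ : forall X : vfield M, J (J X) = sf_cst M alpha *: X) :
  [/\ affine_isomorphism (@connections R n M) (@connections R n M)
        (Jstar alpha J) /\
      (forall D : oper M, connections D -> Jstar alpha J (Jstar alpha J D) = D),
      adapted_connections J =
        [set D : oper M | connections D /\ Jstar alpha J D = D],
      (forall D : oper M, connections D ->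
        Jstar alpha J (Jproj alpha J D) = Jproj alpha J D) /\
      affine_projection (@connections R n M) (adapted_connections J)
        (Jproj alpha J) &
      forall (epsilon : R) (g : semi_riemannian M),
        is_J2_metric alpha epsilon J g ->
        forall Dg : oper M, is_levi_civita g Dg ->
        Jproj alpha J Dg = first_canonical alpha J Dg].
Proof.
have Kstar D : connections D -> Jstar alpha J (Jstar alpha J D) = D.
  exact: JstarK.
have Astar := Jstar_affine halpha hJ.
split.
(* An involution is its own inverse, hence the witness. *)
- split=> //; split=> //; exists (Jstar alpha J).
  by split=> // D /set_mem; exact: Kstar.
- exact: adapted_connectionsE.
- split; last exact: Jproj_projection.
  by move=> D; exact: Jstar_Jproj.
- by move=> epsilon g _ Dg [cDg _ _]; exact: Jproj_first_canonical.
Qed.
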